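(* Let $n$ be an odd positive integer and let $G_n$ be the edge-colored complete graph on the vertex set $\mathbb{Z}_n$ in which the edge $\{i,j\}$ has color $i+j\in\mathbb{Z}_n$. Then the group $\operatorname{CPA}(G_n)$ of color permuting automorphisms of $G_n$ satisfies $$\operatorname{CPA}(G_n)\cong \mathbb{Z}_n\rtimes \operatorname{Aut}(\mathbb{Z}_n).$$
   Context: $\mathbb{Z}_n=\{0,1,\dots,n-1\}$ is the additive cyclic group of integers modulo $n$, and $\operatorname{Aut}(\mathbb{Z}_n)$ is its group of group automorphisms. The semidirect product $\mathbb{Z}_n\rtimes\operatorname{Aut}(\mathbb{Z}_n)$ is taken with respect to the natural action of $\operatorname{Aut}(\mathbb{Z}_n)$ on $\mathbb{Z}_n$ (the holomorph of $\mathbb{Z}_n$). The edge-colored graph $G_n$: its vertex set is $\mathbb{Z}_n$; its edge set $E$ consists of all 2-element subsets $\{i,j\}$ of $\mathbb{Z}_n$ with $i\neq j$ (complete graph); its set of colors is $\mathscr{C}=\mathbb{Z}_n$; its edge-coloring is $c:E\to\mathscr{C}$, $c(\{i,j\})=i+j$ (addition modulo $n$). For an edge-colored simple graph $G=(S,E,c:E\to\mathscr{C})$, a graph automorphism is a bijection $\sigma:S\to S$ such that for all $\alpha,\beta\in S$, $\{\sigma(\alpha),\sigma(\beta)\}\in E$ if and only if $\{\alpha,\beta\}\in E$; it acts on edges by $\sigma(\{\alpha,\beta\})=\{\sigma(\alpha),\sigma(\beta)\}$. A color permuting automorphism of $G$ is a graph automorphism $\chi$ of $(S,E)$ for which there exists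 a permutation $\phi$ of $\mathscr{C}$ with $\phi\circ c=c\circ\chi$ on $E$. These form a group under composition, denoted $\operatorname{CPA}(G)$. *)

(* Defs.v *)
From mathcomp Require Import all_boot all_order all_algebra all_fingroup.

Set Implicit Arguments.
Unset Strict Implicit.
Unset Printing Implicit Defensive.

Import GRing.Theory.

Local Open Scope group_scope.

(* The values of [color] outside [edges] are irrelevant. *)
Record ecgraph (S C : finType) := ECGraph {
  edges : {set {set S}};
  edges_card2 : forall e, e \in edges -> #|e| = 2;
  color : {set S} -> C
}.

Section ColorPermutingAutomorphisms.

Variables (S C : finType) (G : ecgraph S C).

Definition graph_aut (s : {perm S}) : bool :=
  [forall a, forall b, ([set s a; s b] \in edges G) == ([set a; b] \in edges G)].

Definition color_permuting (s : {perm S}) : bool :=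
  [exists phi : {perm C},
     [forall e in edges G, phi (color G e) == color G (s @: e)]].

Definition CPA : {set {perm S}} :=
  [set s | graph_aut s && color_permuting s].

Lemma graph_aut_edge s e :
  graph_aut s -> e \in edges G -> s @: e \in edges G.
Proof.
move=> /forallP sA eE; have /eqP/cards2P [a [b [_ def_e]]] := edges_card2 eE.
have /forallP/(_ b)/eqP := sA a.
by rewrite -def_e eE def_e imsetU1 imset_set1.
Qed.

(* Products in {perm S} compose from left to right, so this is the opposite of
   the group of permutations under the usual composition of functions; the two
   are isomorphic through inversion. *)
Fact CPA_group_set : group_set CPA.
Proof.
apply/group_setP; split=> [|s t].
  rewrite inE; apply/andP; split.
    by apply/forallP=> a; apply/forallP=> b; rewrite !perm1.
  apply/existsP; exists 1; apply/forall_inP=> e _; rewrite perm1.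
  by rewrite (eq_imset _ (@perm1 S)) imset_id.
rewrite !inE => /andP[sA /existsP[f /forall_inP fP]].
move=> /andP[tA /existsP[g /forall_inP gP]]; apply/andP; split.
  apply/forallP=> a; apply/forallP=> b; rewrite !permM.
  have /forallP/(_ (s b))/eqP-> := forallP tA (s a).
  by have /forallP/(_ b) := forallP sA a.
apply/existsP; exists (f * g); apply/forall_inP=> e eE; rewrite permM.
rewrite (eqP (fP _ eE)) (eqP (gP _ (graph_aut_edge sA eE))).
by rewrite -imset_comp (eq_imset _ (permM s t)).
Qed.

Canonical CPA_group := Group CPA_group_set.

End ColorPermutingAutomorphisms.

(* For n > 0 this is 'I_n with its addition modulo n; 'Z_n would be wrong at
   n = 1, where it denotes the integers modulo 2. *)
Notation Zmod n := 'I_n.-1.+1.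

Section SumColoring.

Variable n : nat.

Definition sum_edges : {set {set Zmod n}} :=
  [set e : {set Zmod n} | #|e| == 2].

Fact sum_edges_card2 (e : {set Zmod n}) :
  e \in sum_edges -> #|e| = 2.
Proof. by rewrite inE => /eqP. Qed.

Definition sum_color (e : {set Zmod n}) : Zmod n := (\sum_(i in e) i)%R.

Definition sum_graph : ecgraph (Zmod n) (Zmod n) :=
  ECGraph sum_edges_card2 sum_color.

Lemma sum_colorE (i j : Zmod n) :
  i != j -> color sum_graph [set i; j] = (i + j)%R.
Proof. by move=> ij; rewrite /= /sum_color big_setU1 ?inE // big_set1. Qed.

End SumColoring.

(* External semidirect product for the action x |-> a x of the automorphisms a;
   the pair (a, x) stands for the product of a and x, so that
   (a, x) * (b, y) = (a * b, b x + y). *)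
Definition holomorph (n : nat) :=
  [set: sdprod_by [Aut [set: Zmod n]]%gact].

(* Main.v *)
Require Import Defs.
From mathcomp Require Import all_boot all_order all_algebra all_fingroup.

(** Every affine map x |-> a x + b of Z_n, with a an automorphism, multiplies
    colors by a and then shifts them by 2b, so it permutes the colors.
    Conversely, let s permute the colors through phi, so that
    phi (i + j) = s i + s j whenever i <> j.  The point is that this identity
    then holds for i = j too ([sum_perm_diag]).  Once it does,
    s i + s j = phi (i + j) = s (i + j) + s 0 for all i and j, which says that
    x |-> s x - s 0 is additive, that is, that s is affine.  So the color
    permuting automorphisms are exactly the affine permutations, and these form
    a faithful copy of the holomorph ([injm_affine_perm], [im_affine_perm]). *)

Local Open Scope group_scope.

(** * The holomorph as a group of affine permutations *)

Section AffinePermutations.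

Variable gT : finGroupType.

Local Notation hol := (sdprod_by [Aut [set: gT]]%gact).

(** The automorphism comes first and the translation last, because the pair
    (a, x) of the semidirect product is the product of a and x in this order
    and permutations compose from left to right. *)
Definition affine_perm (u : hol) : {perm gT} := u.1 * perm (@mulIg gT u.2).

Lemma affine_permE (u : hol) (z : gT) : affine_perm u z = u.1 z * u.2.
Proof. by rewrite permM permE. Qed.

Lemma hol_autM (u : hol) : {morph (u.1 : {perm gT}) : x y / x * y}.
Proof.
case: u => [[a x] /= /setXP[aA _]] y z.
by rewrite (morphicP (Aut_morphic aA)) ?inE.
Qed.

Lemma hol_aut1 (u : hol) : (u.1 : {perm gT}) 1 = 1.
Proof. by apply: (mulgI (u.1 1)); rewrite -hol_autM !mulg1. Qed.

Lemma affine_permM : {in [set: hol] &, {morph affine_perm : u v / u * v}}.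
Proof.
move=> u v _ _; apply/permP=> z.
by rewrite permM !affine_permE /= permM hol_autM mulgA.
Qed.

Canonical affine_perm_morphism := Morphism affine_permM.

(** An affine permutation determines its translation by its value at 1, and
    then its automorphism. *)
Lemma injm_affine_perm : 'injm affine_perm.
Proof.
apply/injmP=> u v _ _ /permP eq_uv; apply/val_inj.
have eq2 : u.2 = v.2 by have := eq_uv 1; rewrite !affine_permE !hol_aut1 !mul1g.
have eq1 : u.1 = v.1.
  by apply/permP=> z; have := eq_uv z; rewrite !affine_permE eq2 => /mulIg.
by rewrite /= [pair_of_sd u]surjective_pairing eq1 eq2 -surjective_pairing.
Qed.

(** The condition says that z |-> s z * (s 1)^-1 is multiplicative, without
    naming this automorphism. *)
Lemma im_affine_perm (s : {perm gT}) :
  reflect (forall y z, s (y * z) = s y * (s 1)^-1 * s z)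
          (s \in affine_perm @* [set: hol]).
Proof.
apply: (iffP morphimP) => [[u _ _ ->] y z | sM].
  by rewrite !affine_permE hol_aut1 mul1g hol_autM mulgK mulgA.
pose a := s * perm (@mulIg gT (s 1)^-1).
have aE z : a z = s z * (s 1)^-1 by rewrite permM permE.
have aA : (a, s 1) \in setX (Aut [set: gT]) [set: gT].
  rewrite !inE andbT; apply/andP; split; first by apply/subsetP=> x; rewrite inE.
  by apply/morphicP=> y z _ _; rewrite !aE sM mulgA.
exists (SdPair [Aut [set: gT]]%gact aA); rewrite ?inE //.
by apply/permP=> z; rewrite affine_permE /= aE mulgKV.
Qed.

End AffinePermutations.

(** * Permutations that permute sums of distinct elements *)

Local Open Scope ring_scope.
Import GRing.Theory.

Section SumPermuting.

Variables (V : finZmodType) (s phi : {perm V}).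

Hypothesis sum_perm : forall i j, i != j -> phi (i + j) = s i + s j.

(** Let k be the vertex with s k = phi (i + i) - s i.  Were k distinct from i,
    then phi (i + k) = s i + s k = phi (i + i), and injectivity of phi would
    give k = i after all. *)
Lemma sum_perm_diag i : phi (i + i) = s i + s i.
Proof.
pose k := (s^-1)%g (phi (i + i) - s i).
have sk : s i + s k = phi (i + i) by rewrite permKV addrC subrK.
have [ik | /sum_perm] := eqVneq i k; first by rewrite -sk -ik.
by rewrite sk => /perm_inj/addrI ki; rewrite -sk ki.
Qed.

Lemma sum_perm_affine i j : s (i + j) = s i - s 0 + s j.
Proof.
have sum_permT x y : phi (x + y) = s x + s y.
  by have [-> | /sum_perm//] := eqVneq x y; apply: sum_perm_diag.
have e : s i + s j = s (i + j) + s 0 by rewrite -!sum_permT addr0.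
by rewrite addrAC e addrK.
Qed.

End SumPermuting.

(** * Color permuting automorphisms of the sum coloring *)

(** The complete graph imposes nothing on a permutation, so only the condition
    on colors is left. *)
Lemma CPA_sum_graphP (n : nat) (s : {perm Zmod n}) :
  reflect (exists phi : {perm Zmod n},
             forall i j, i != j -> phi (i + j) = s i + s j)
          (s \in CPA (sum_graph n)).
Proof.
have graph_aut_s : graph_aut (sum_graph n) s.
  apply/'forall_forallP=> a b.
  by rewrite !inE !cards2 (inj_eq perm_inj).
rewrite inE graph_aut_s; apply: (iffP existsP) => -[phi].
  move=> /forall_inP phiP; exists phi => i j ij.
  have eE : [set i; j] \in edges (sum_graph n) by rewrite inE cards2 ij.
  have := eqP (phiP _ eE).
  by rewrite imsetU1 imset_set1 !sum_colorE ?(inj_eq perm_inj).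
move=> phiP; exists phi; apply/forall_inP=> e.
rewrite inE => /cards2P[i [j [ij ->]]].
by rewrite imsetU1 imset_set1 !sum_colorE ?(inj_eq perm_inj) ?phiP.
Qed.

Lemma CPA_sum_graph_affine (n : nat) :
  CPA (sum_graph n) = (@affine_perm (Zmod n) @* holomorph n)%g.
Proof.
apply/setP=> s; apply/CPA_sum_graphP/im_affine_perm => [[phi phiP] | sM].
  exact: sum_perm_affine phiP.
(* If s x = a x + b with b = s 0, then a c + 2b = s c + b. *)
exists (s * perm (addIr (s 0)))%g => i j _; rewrite permM permE.
by have -> := sM i j; rewrite addrAC subrK.
Qed.

Local Close Scope ring_scope.

Theorem theorem1p1 (n : nat) (n_odd : odd n) :
  CPA (sum_graph n) \isog holomorph n.
Proof.
rewrite CPA_sum_graph_affine isog_sym.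
exact: sub_isog (subxx _) (injm_affine_perm _).
Qed.
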